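(* There is a function $\eta(K)$ of $K$ alone with $\eta(K)\to 0$ as $K\to\infty$ (denoted $o_K(1)$) such that the following holds. Let $K\ge1$ and $t\ge2$ be integers, let $0<\delta<1/2$ be such that $L=\delta K$ is an integer, let $H=(1-\delta)K$, and let $n\ge tK$. In the random-observer model described in the context with $n$ processes and $t$ simultaneously failed processes, for every process $z$ receiving all the failure alerts, the bad event $B(z)$ satisfies $$\Pr[B(z)]\le \binom{t}{2}\,2^{-2\,(1-H_2(\delta)-o_K(1))\,K}.$$
   Context: $H_2(\delta)=-\delta\log_2\delta-(1-\delta)\log_2(1-\delta)$ is the binary entropy function (not to be confused with the threshold $H$). Model: in a cluster of $n$ processes, $t$ processes $a_1,\dots,a_t$ fail simultaneously. Each failed process $a_i$ has a set $O_i$ of $K$ observers, and the sets $O_1,\dots,O_t$ are pairwise disjoint. The union $O=O_1\cup\dots\cup O_t$, of size $tK$, is chosen uniformly at random among the $tK$-element subsets of the $n$ processes, and is then partitioned uniformly at random into the $t$ blocks $O_1,\dots,O_t$ of size $K$. Every observer in $O_i$ broadcasts one alert message about $a_i$, and $z$ receives all $tK$ messages one after another; the order in which $z$ receives messages from different senders is a fixed linear order on senders, not depending on the random choice of the $O_i$. (Equivalently, the sequence of indices $i$ of the blocks from which the successive messages at $z$ originate is uniformly distributed over all sequences of length $tK$ in which each $i\in\{1,\dots,t\}$ appears exactly $K$ times.) Bad event $B(z)$: there exists $S\subsetneq\{1,\dots,t\}$ with $1\le|S|<K$ such that $z$ receives $H$ or more messages from $O_i$ for every $i\in S$ before it receives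 more than $L$ messages from $O_j$ for any $j\in\{1,\dots,t\}\setminus S$; that is, at some point in the message sequence, $z$ has received at least $H$ messages from $O_i$ for every $i\in S$ and at most $L$ messages from $O_j$ for every $j\notin S$. *)

(* Defs.v *)
From HB Require Import structures.
From mathcomp Require Import all_boot all_order all_algebra.
From mathcomp Require Import all_classical all_reals all_analysis.

Set Implicit Arguments.
Unset Strict Implicit.
Unset Printing Implicit Defensive.

Import Order.TTheory GRing.Theory Num.Theory.
Import numFieldNormedType.Exports.

Local Open Scope set_scope.
Local Open Scope ring_scope.

Definition log2 (R : realType) (x : R) : R := ln x / ln 2.

Definition H2 (R : realType) (d : R) : R :=
  - d * log2 d - (1 - d) * log2 (1 - d).

(* Expectation of [f x] for [x] uniform in [A]. *)
Definition unif_mean (R : realType) (T : finType) (A : {set T}) (f : T -> R)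
    : R :=
  (\sum_(x in A) f x) / #|A|%:R.

Definition linear_order (T : Type) (le : rel T) : Prop :=
  [/\ reflexive le, antisymmetric le, transitive le & total le].

(* An assignment of observers: [O i] is the set of observers of the i-th failed
   process. *)
Definition observers (n t : nat) := {ffun 'I_t -> {set 'I_n}}.

Definition obs_unions (n t K : nat) : {set {set 'I_n}} :=
  [set U : {set 'I_n} | #|U| == (t * K)%N]%SET.

(* Ordered partitions of [U] into [t] blocks of size [K]. *)
Definition obs_blocks (n t K : nat) (U : {set 'I_n}) : {set observers n t} :=
  [set O : observers n t |
    [&& (\bigcup_(i < t) O i)%SET == U,
        [forall i, #|O i| == K] &
        [forall i, forall j, (i != j) ==> [disjoint O i & O j]]]]%SET.

(* Two-stage draw: first the union, uniformly, then its partition, uniformly. *)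
Definition obs_Pr (R : realType) (n t K : nat) (E : pred (observers n t)) : R :=
  unif_mean (obs_unions n t K)
    (fun U => unif_mean (obs_blocks t K U) (fun O => (E O)%:R)).

(* Each observer sends exactly one alert, so the alerts received by a process
   are identified with their senders; [before] is the order of reception. *)
Definition arrivals (n t : nat) (before : rel 'I_n) (O : observers n t)
    : seq 'I_n :=
  sort before (enum (\bigcup_(i < t) O i)%SET).

(* Number of alerts from [O i] among the first [m] alerts received. *)
Definition nrecv (n t : nat) (before : rel 'I_n) (O : observers n t)
    (m : nat) (i : 'I_t) : nat :=
  count (fun p => p \in O i) (take m (arrivals before O)).

Definition bad_event (n t K L H : nat) (before : rel 'I_n) (O : observers n t)
    : bool :=
  [exists S : {set 'I_t},
    [&& S \proper [set: 'I_t]%SET, (1 <= #|S|)%N, (#|S| < K)%N &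
      [exists m : 'I_(t * K).+1,
        [forall i in S, (H <= nrecv before O m i)%N] &&
        [forall j in (~: S)%SET, (nrecv before O m j <= L)%N]]]].

(* Main.v *)
Require Import Defs.
From HB Require Import structures.
From mathcomp Require Import all_boot all_order all_algebra.
From mathcomp Require Import all_classical all_reals all_analysis.
From mathcomp Require Import zify ring lra.

(** The bad event provides a pair [i != j] such that some prefix of the alerts
    contains at least [H] alerts from [O i] and at most [L] from [O j]. As
    [H + L = K], already the first [K] alerts from [W = O i :|: O j] then contain
    at least [H] from [O i]. Given the other blocks, [O i] is a uniform
    [K]-subset of the [2K]-set [W], so it misses at most [L] of the first [K]
    elements of [W] and meets the last [K] in at most [L]: this has probability
    at most [(\sum_(l <= L) 'C(K, l)) ^ 2 / 'C(2K, K)]. The numerator is at most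
    [2 `^ (2 * H2 delta * K)], the denominator at least [4 ^ K / (2K + 1)], and
    the factor [2 * (2K + 1)] left by the union bound over ordered pairs is
    absorbed in [eta]. *)

Set Implicit Arguments.
Unset Strict Implicit.
Unset Printing Implicit Defensive.

Import Order.TTheory GRing.Theory Num.Theory.
Import numFieldNormedType.Exports.
(* The finite-set lemmas, shadowed by their homonyms in [classical_sets]. *)
Import boot.fintype boot.finset.

(** * Prefixes of sorted sequences *)

Lemma filter_sort_enum (T : finType) (le : rel T) (W U : {set T}) :
  linear_order le -> W \subset U ->
  [seq x <- sort le (enum U) | x \in W] = sort le (enum W).
Proof.
move=> [_ _ le_tr le_tot] sWU; rewrite filter_sort //; congr sort.
rewrite /enum_mem -filter_predI; apply: eq_filter => x /=.
by case: (boolP (x \in W)) => // /(subsetP sWU).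
Qed.

(** Lets a prefix of all alerts be read as a prefix of the alerts of two blocks only. *)
Lemma take_filter (T : Type) (p : pred T) (s : seq T) (m : nat) :
  [seq x <- take m s | p x] = take (count p (take m s)) [seq x <- s | p x].
Proof.
by rewrite -{3}(cat_take_drop m s) filter_cat -size_filter take_size_cat.
Qed.

(* Whether the prefix is shorter or longer than [H + L], comparing it with the
   prefix of length exactly [H + L] preserves one of the two bounds. *)
Lemma count_take_threshold (T : Type) (a : pred T) (s : seq T) (m H L : nat) :
  (H + L <= size s)%N ->
  (H <= count a (take m s))%N -> (count (predC a) (take m s) <= L)%N ->
  (H <= count a (take (H + L) s))%N.
Proof.
move=> size_s Ha La; case: (leqP m (H + L)) => [le_m|/ltnW le_m].
  by apply: leq_trans Ha _; rewrite -(subnKC le_m) takeD count_cat leq_addr.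
have: (count (predC a) (take (H + L) s) <= L)%N.
  apply: leq_trans La.
  by rewrite -(subnKC le_m) (takeD (H + L)) count_cat leq_addr.
have := count_predC a (take (H + L) s); rewrite size_takel // => e ?; lia.
Qed.

(** * From the bad event to a pair of blocks *)

Lemma obs_blocksP (n t K : nat) (U : {set 'I_n}) (O : observers n t) :
  reflect [/\ (\bigcup_(i < t) O i) = U, forall i, #|O i| = K &
              forall i j, i != j -> [disjoint O i & O j]]
          (O \in obs_blocks t K U).
Proof.
rewrite inE; apply: (iffP and3P) => [[/eqP-> /forallP cK /forallP dO]|].
  split=> // i; first exact/eqP.
  by move=> j ij; move/forallP: (dO i) => /(_ j) /implyP; apply.
move=> [-> cK dO]; split=> //; first by apply/forallP => i; rewrite cK.
by apply/forallP => i; apply/forallP => j; apply/implyP; exact: dO.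
Qed.

(** Observing at the fixed time [K], within [W] alone, removes the unknown time [m] of the bad
    event. *)
Definition leads (T : finType) (K H : nat) (le : rel T) (W A : {set T}) : bool :=
  (H <= count [in A] (take K (sort le (enum W))))%N.

Lemma cardsU_blocks (n t K : nat) (U : {set 'I_n}) (O : observers n t)
    (i j : 'I_t) :
  O \in obs_blocks t K U -> i != j -> #|(O i :|: O j)| = K.*2.
Proof.
case/obs_blocksP=> _ cK dO ij.
by rewrite cardsU (disjoint_setI0 (dO _ _ ij)) cards0 subn0 !cK addnn.
Qed.

Lemma bad_event_leads (n t K L H : nat) (before : rel 'I_n) (U : {set 'I_n})
    (O : observers n t) :
  linear_order before -> (H + L)%N = K -> O \in obs_blocks t K U ->
  bad_event K L H before O ->
  exists i j, i != j /\ leads K H before (O i :|: O j) (O i).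
Proof.
move=> le_lin HLK OB; case/obs_blocksP: (OB) => _ cK dO.
case/existsP=> S /and4P[Sprop S_gt0 _ /existsP[m /andP[/forallP SH /forallP SL]]].
(* Any [i] in [S] and any [j] outside [S] will do. *)
case/card_gt0P: S_gt0 => i iS; case/properP: Sprop => _ [j _ jS].
have ij : i != j by apply: contraNneq jS => <-.
exists i, j; split=> //.
have /= Hi := implyP (SH i) iS.
have /= Lj : (nrecv before O m j <= L)%N by apply: (implyP (SL j)); rewrite inE.
set W := (O i :|: O j).
have WU : W \subset (\bigcup_(k < t) O k) by rewrite subUset !bigcup_sup.
(* The first [m] alerts, restricted to [W], form a prefix of the sorted [W]; its length is the
   number of alerts from [W] among them. *)
have nrecvW (k : 'I_t) : O k \subset W -> nrecv before O m k =
    count [in O k] (take (count [in W] (take m (arrivals before O)))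
                      (sort before (enum W))).
  move=> kW; rewrite -(filter_sort_enum le_lin WU) -take_filter count_filter.
  apply: eq_count => x /=.
  by case: (boolP (x \in O k)) => // /(subsetP kW) ->.
(* Inside [W], membership in [O j] is the complement of membership in [O i], so the bound [L] has
   the form that [count_take_threshold] expects. *)
have memW (x : 'I_n) : x \in sort before (enum W) -> (x \in O j) = (x \notin O i).
  rewrite mem_sort mem_enum inE.
  have := disjointFr (dO _ _ ij) (x := x).
  by case: (x \in O i) => //= ->.
rewrite nrecvW ?subsetUl // in Hi; rewrite nrecvW ?subsetUr // in Lj.
rewrite /leads -HLK; apply: count_take_threshold Hi _.
  by rewrite size_sort -cardE (cardsU_blocks OB ij) HLK -addnn leq_addr.
apply: leq_trans Lj; rewrite leq_eqVlt; apply/orP; left; apply/eqP.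
by apply: eq_in_count => x /mem_take /memW ->.
Qed.

(** * Leading [K]-subsets of a fixed [2K]-set *)

Definition small_subsets (T : finType) (V : {set T}) (L : nat) : {set {set T}} :=
  [set X : {set T} | (X \subset V) && (#|X| <= L)%N].

(* [A] is recovered from [V :\: A] and [A :\: V], both of which are small. *)
Lemma card_leads (T : finType) (K L H : nat) (le : rel T) (W : {set T}) (N : nat) :
  (H + L)%N = K -> #|W| = K.*2 ->
  (forall V : {set T}, #|V| = K -> (#|small_subsets V L| <= N)%N) ->
  (#|[set A : {set T} | [&& A \subset W, #|A| == K & leads K H le W A]]|
     <= N * N)%N.
Proof.
move=> HLK cW smallN; set s := take K (sort le (enum W)).
have us : uniq s by rewrite take_uniq // sort_uniq enum_uniq.
have ss : size s = K.
  by rewrite size_takel // size_sort -cardE cW -addnn leq_addr.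
pose V : {set T} := [set x in s].
have cV : #|V| = K by rewrite cardsE (card_uniqP us).
have VW : V \subset W.
  by apply/subsetP => x; rewrite inE => /mem_take; rewrite mem_sort mem_enum.
have cWV : #|(W :\: V)| = K.
  by rewrite cardsD (setIidPr VW) cV cW; lia.
pose f (A : {set T}) := ((V :\: A), (A :\: V)).
apply: leq_trans (leq_mul (smallN V cV) (smallN _ cWV)); rewrite -cardsX.
rewrite -(@card_in_imset _ _ f); last first.
  move=> A A' _ _ [/setP eV /setP eW]; apply/setP => x.
  have := eV x; have := eW x; rewrite !inE.
  by case: (x \in s) => /=; case: (x \in A); case: (x \in A').
apply: subset_leq_card; apply/subsetP => _ /imsetP[A + ->].
rewrite !inE => /and3P[AW /eqP cA]; rewrite /leads -/s => HA.
(* As [V] and [A] both have [K] elements, [V :\: A] and [A :\: V] have size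
   [K - #|V :&: A| <= K - H = L]. *)
have cVA : (H <= #|(V :&: A)|)%N.
  rewrite -(size_filter) in HA; apply: leq_trans HA _.
  rewrite -(card_uniqP (filter_uniq _ us)); apply: subset_leq_card.
  by apply/subsetP => x; rewrite mem_filter !inE andbC.
rewrite subsetDl setSD // !cardsD cV cA (setIC A); lia.
Qed.

(** * Redistribution of two blocks *)

Definition exchange (n t : nat) (i j : 'I_t) (O : observers n t) (A : {set 'I_n})
    : observers n t :=
  [ffun k => if k == i then A
             else if k == j then ((O i :|: O j) :\: A) else O k].

(** The two new blocks split the old [O i :|: O j], hence the total union and the disjointness from
    the other blocks persist. *)
Lemma exchange_blocks (n t K : nat) (U : {set 'I_n}) (i j : 'I_t)
    (O : observers n t) (A : {set 'I_n}) :
  i != j -> O \in obs_blocks t K U -> A \subset (O i :|: O j) -> #|A| = K ->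
  exchange i j O A \in obs_blocks t K U.
Proof.
move=> ij OB AW cA; case/obs_blocksP: (OB) => eU cK dO.
have ji : (j == i) = false by rewrite eq_sym (negbTE ij).
have exi : exchange i j O A i = A by rewrite ffunE eqxx.
have exj : exchange i j O A j = ((O i :|: O j) :\: A) by rewrite ffunE ji eqxx.
have exU : (exchange i j O A i :|: exchange i j O A j = O i :|: O j).
  by rewrite exi exj -{1}(setIidPr AW) setID.
have exk k : k != i -> k != j -> exchange i j O A k = O k.
  by move=> /negbTE ki /negbTE kj; rewrite ffunE ki kj.
have dW k : k != i -> k != j -> [disjoint (O i :|: O j) & O k].
  move=> ki kj; rewrite -setI_eq0 setIUl setU_eq0 !setI_eq0.
  by rewrite !dO // eq_sym.
have dex k l : k \in [:: i; j] -> l != i -> l != j ->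
    [disjoint exchange i j O A k & exchange i j O A l].
  move=> kij li lj; rewrite (exk l) //; apply: disjointWl (dW _ li lj).
  rewrite -exU; case/or3P: kij => // /eqP->; [exact: subsetUl|exact: subsetUr].
have dij : [disjoint exchange i j O A i & exchange i j O A j].
  by rewrite exi exj -setI_eq0 setIDA setDIl setDv set0I.
apply/obs_blocksP; split.
- rewrite -eU (bigD1 i) //= (bigD1 j) 1?eq_sym //=.
  rewrite [RHS](bigD1 i) //= [X in _ = _ :|: X](bigD1 j) 1?eq_sym //= !setUA exU.
  by congr (_ :|: _); apply: eq_bigr => k /andP[ki kj]; rewrite exk.
- move=> k; have [->|ki] := eqVneq k i; first by rewrite exi.
  have [->|kj] := eqVneq k j; last by rewrite exk.
  by rewrite exj cardsD (setIidPr AW) cA (cardsU_blocks OB ij); lia.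
- move=> k l kl.
  have [k_ij|k_ij] := boolP (k \in [:: i; j]);
    have [l_ij|l_ij] := boolP (l \in [:: i; j]).
  + move: k_ij l_ij kl; rewrite !inE.
    case/orP=> /eqP->; case/orP=> /eqP->; rewrite ?eqxx // => _.
    by rewrite disjoint_sym.
  + by move: l_ij; rewrite !inE negb_or => /andP[]; exact: dex.
  + by move: k_ij; rewrite !inE negb_or disjoint_sym => /andP[]; exact: dex.
  + move: k_ij l_ij; rewrite !inE !negb_or => /andP[ki kj] /andP[li lj].
    by rewrite !exk // dO.
Qed.

(* Given the other blocks, [O i] is uniform among the [K]-subsets of
   [O i :|: O j]: the pairs [(O, A)] are permuted by the involution that
   replaces [O i] with [A] and remembers the old [O i]. *)
Lemma card_blocks_pair (n t K N : nat) (U : {set 'I_n}) (i j : 'I_t)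
    (P : {set 'I_n} -> {set 'I_n} -> bool) :
  i != j ->
  (forall W : {set 'I_n}, #|W| = K.*2 ->
     (#|[set A : {set 'I_n} | [&& A \subset W, #|A| == K & P W A]]| <= N)%N) ->
  (#|[set O in obs_blocks t K U | P (O i :|: O j) (O i)]| * 'C(K.*2, K)
     <= #|obs_blocks t K U| * N)%N.
Proof.
move=> ij PN; set B := obs_blocks t K U.
have cB O : O \in B -> #|O i| = K by case/obs_blocksP.
have dB O : O \in B -> [disjoint O i & O j].
  by case/obs_blocksP=> _ _; apply.
have cW O (OB : O \in B) : #|O i :|: O j| = K.*2 := cardsU_blocks OB ij.
have exB O (A : {set 'I_n}) : O \in B -> A \subset O i :|: O j -> #|A| = K ->
    exchange i j O A \in B by exact: exchange_blocks.
clearbody B.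
pose T := (observers n t * {set 'I_n})%type.
(* [P] bears on the block [O i] in [X] and on the drawn set [A] in [Y]; [f] swaps these two sets. *)
pose X : {set T} := [set p : T | [&& p.1 \in B, P (p.1 i :|: p.1 j) (p.1 i),
   p.2 \subset (p.1 i :|: p.1 j) & #|p.2| == K]].
pose Y : {set T} := [set p : T | [&& p.1 \in B, p.2 \subset (p.1 i :|: p.1 j),
   #|p.2| == K & P (p.1 i :|: p.1 j) p.2]].
have ji : (j == i) = false by rewrite eq_sym (negbTE ij).
pose f (p : T) : T := (exchange i j p.1 p.2, p.1 i).
have exU (O : observers n t) (A : {set 'I_n}) : A \subset (O i :|: O j) ->
    (exchange i j O A i :|: exchange i j O A j = O i :|: O j).
  by move=> AW; rewrite !ffunE eqxx ji eqxx -{1}(setIidPr AW) setID.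
have fK : {in X, cancel f f}.
  move=> [Q A]; rewrite inE /= => /and4P[OB _ AW _].
  rewrite /f /=; congr pair; last by rewrite ffunE eqxx.
  apply/ffunP => k; rewrite ffunE exU //.
  have [->//|ki] := eqVneq k i; have [->|kj] := eqVneq k j.
    rewrite setDUl setDv set0U; apply/setDidPl.
    by rewrite disjoint_sym dB.
  by rewrite ffunE (negbTE ki) (negbTE kj).
have XY : (#|X| <= #|Y|)%N.
  rewrite -(card_in_imset (can_in_inj fK)); apply: subset_leq_card.
  apply/subsetP => _ /imsetP[[Q A] + ->].
  rewrite !inE /= => /and4P[OB PO AW /eqP cA].
  rewrite exU // PO subsetUl exB //=.
  by rewrite cB ?eqxx.
(* Each [O] is paired with all ['C(K.*2, K)] subsets of size [K] of its [W]. *)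
have -> : (#|[set O in B | P (O i :|: O j) (O i)]| * 'C(K.*2, K) = #|X|)%N.
  rewrite -sum_nat_const -sum1_card.
  transitivity (\sum_(O in [set O in B | P (O i :|: O j) (O i)])
     \sum_(A : {set 'I_n} | (A \subset O i :|: O j) && (#|A| == K)) 1)%N.
    apply: eq_bigr => O; rewrite inE => /andP[OB _].
    by rewrite sum1dep_card cards_draws cW.
  by rewrite pair_big_dep; apply: eq_bigl; case=> O A; rewrite !inE /= -?andbA.
apply: leq_trans XY _; rewrite -sum_nat_const -sum1_card.
apply: (@leq_trans (\sum_(O in B) \sum_(A : {set 'I_n} | [&& A \subset (O i :|: O j),
   #|A| == K & P (O i :|: O j) A]) 1)%N).
  by rewrite pair_big_dep; apply: eq_leq; apply: eq_bigl; case=> O A; rewrite !inE /= -?andbA.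
by apply: leq_sum => O OB; rewrite sum1dep_card PN // cW.
Qed.

(** * Binomial and entropy estimates *)

Lemma central_binomial_ge (K : nat) : (4 ^ K <= K.*2.+1 * 'C(K.*2, K))%N.
Proof.
elim: K => [|K IH]; first by rewrite bin0.
have e1 := mul_bin_diag K.+1.*2 K.
have e2 := mul_bin_down K.*2.+1 K.
rewrite doubleS /= in e1 *; rewrite /= in e2.
have e2' : (K.*2.+1 * 'C(K.*2, K) = K.+1 * 'C(K.*2.+1, K))%N.
  by rewrite e2; congr muln; lia.
(* The right-hand side grows by the factor [2 (2K + 3) / (K + 1) >= 4]. *)
rewrite expnS; nia.
Qed.

Local Open Scope ring_scope.

(** The index range is that of [exprDn], so that the sum is a part of a binomial expansion. *)
Definition binomial_head (K L : nat) : nat :=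
  (\sum_(k < K.+1 | (k <= L)%N) 'C(K, k))%N.

Lemma card_small_subsets (T : finType) (V : {set T}) (L : nat) :
  #|small_subsets V L| = binomial_head #|V| L.
Proof.
rewrite -sum1_card.
rewrite (partition_big (fun X : {set T} => inord #|X| : 'I_#|V|.+1)
  (fun k : 'I_#|V|.+1 => (k <= L)%N)) /=; last first.
  by move=> X; rewrite inE => /andP[XV XL]; rewrite inordK // ltnS subset_leq_card.
apply: eq_bigr => k kL; rewrite -cards_draws sum1dep_card; apply: eq_card => X.
rewrite !inE; case: (boolP (X \subset V)) => //= XV.
rewrite -val_eqE /= inordK ?ltnS ?subset_leq_card //.
by case: eqP => [->|]; rewrite ?kL ?andbF.
Qed.

(* In the binomial expansion of [(d + (1 - d)) ^+ K], each of the subsets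
   counted by [binomial_head K L] has weight at least [d ^+ L * (1 - d) ^+ (K - L)]. *)
Lemma binomial_head_le (R : realType) (K L : nat) (d : R) :
  0 < d -> d < 1 / 2 -> (L <= K)%N ->
  (binomial_head K L)%:R * (d ^+ L * (1 - d) ^+ (K - L)) <= 1.
Proof.
move=> d_gt0 d_lt LK; have d1 : d <= 1 - d by lra.
have d1_ge0 : 0 <= 1 - d by lra.
have d_sum : 1 = \sum_(k < K.+1) (1 - d) ^+ (K - k) * d ^+ k *+ 'C(K, k) :> R.
  by rewrite -exprDn subrK expr1n.
rewrite [leRHS]d_sum (bigID (fun k : 'I_K.+1 => (k <= L)%N)) /=.
rewrite -[leLHS]addr0 lerD //; last first.
  by apply: sumr_ge0 => k _; rewrite mulrn_wge0 // mulr_ge0 ?exprn_ge0 // ltW.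
rewrite /binomial_head natr_sum mulr_suml; apply: ler_sum => k kL.
rewrite -[leRHS]mulr_natl ler_wpM2l //.
(* For [k <= L], trade [L - k] factors [d] for the larger [1 - d]. *)
rewrite -{1}(subnKC kL) exprD -mulrA [leRHS]mulrC.
rewrite ler_wpM2l ?exprn_ge0 ?(ltW d_gt0) //.
have -> : (K - k = (L - k) + (K - L))%N by lia.
by rewrite exprD ler_wpM2r ?exprn_ge0 // lerXn2r ?nnegrE ?(ltW d_gt0).
Qed.

(** By the values of [L] and [H], [- H2 d * K = L * log2 d + H * log2 (1 - d)]. *)
Lemma powR2_H2 (R : realType) (K L H : nat) (d : R) :
  0 < d -> d < 1 -> L%:R = d * K%:R -> H%:R = (1 - d) * K%:R ->
  2 `^ (- (H2 d * K%:R)) = d ^+ L * (1 - d) ^+ H.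
Proof.
move=> d_gt0 d_lt1 LK HK.
have ln2 : ln 2 != 0 :> R by rewrite gt_eqF // ln_gt0 // ltr1n.
have powE (x : R) n : 0 < x -> x ^+ n = expR (n%:R * ln x).
  by move=> x0; rewrite expRM_natl lnK.
rewrite (powE d) // (powE (1 - d)) ?subr_gt0 // -expRD.
rewrite /powR gt_eqF // LK HK /H2 /log2; congr expR; field.
exact: ln2.
Qed.

(** * Union bound *)

Lemma unif_mean_le (R : realType) (T : finType) (A : {set T}) (f : T -> R) (c : R) :
  0 <= c -> \sum_(x in A) f x <= c * #|A|%:R -> unif_mean A f <= c.
Proof.
(* The mean over an empty [A] is [0], as [0^-1 = 0]; there the bound is [0 <= c]. *)
move=> c_ge0 fc; rewrite /unif_mean; case: (posnP #|A|) => [->|A_gt0].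
  by rewrite invr0 mulr0.
by rewrite ler_pdivrMr // ltr0n.
Qed.

Lemma card_bad_event (n t K L H : nat) (before : rel 'I_n) (U : {set 'I_n}) :
  linear_order before -> (H + L)%N = K ->
  (#|[set O in obs_blocks t K U | bad_event K L H before O]| * 'C(K.*2, K)
     <= 'C(t, 2).*2 * (#|obs_blocks t K U| * binomial_head K L ^ 2))%N.
Proof.
move=> le_lin HLK; set B := obs_blocks t K U.
pose E (p : 'I_t * 'I_t) :=
  [set O in B | leads K H before (O p.1 :|: O p.2) (O p.1)].
have ED (p : 'I_t * 'I_t) : p.1 != p.2 ->
    (#|E p| * 'C(K.*2, K) <= #|B| * binomial_head K L ^ 2)%N.
  move=> ij; apply: (@card_blocks_pair n t K (binomial_head K L ^ 2) U _ _
    (leads K H before) ij) => W cW.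
  rewrite expnS expn1; apply: card_leads HLK cW _ => V cV.
  by rewrite card_small_subsets cV.
have badE : (#|[set O in B | bad_event K L H before O]|
    <= \sum_(p : 'I_t * 'I_t | p.1 != p.2) #|E p|)%N.
  have cardU : (#|\bigcup_(p : 'I_t * 'I_t | p.1 != p.2) E p|
      <= \sum_(p : 'I_t * 'I_t | p.1 != p.2) #|E p|)%N.
    elim/big_ind2: _ => [|a X b Y Xa Yb|//]; first by rewrite cards0.
    exact: leq_trans (leq_of_leqif (leq_card_setU X Y)) (leq_add Xa Yb).
  apply: leq_trans cardU.
  apply: subset_leq_card; apply/subsetP => Q; rewrite inE => /andP[QB].
  case/(bad_event_leads le_lin HLK QB) => i [j [ij Qij]].
  by apply/bigcupP; exists (i, j) => //; rewrite inE QB.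
(* All [t ^ 2] pairs minus the [t] diagonal ones. *)
have pairsE : #|[pred p : 'I_t * 'I_t | p.1 != p.2]| = 'C(t, 2).*2.
  have := cardC [pred p : 'I_t * 'I_t | p.1 == p.2].
  rewrite card_prod card_ord.
  have -> : #|[pred p : 'I_t * 'I_t | p.1 == p.2]| = t.
    rewrite -[RHS]card_ord -(card_codom (f := fun i : 'I_t => (i, i))) //; last first.
      by move=> ? ? [].
    apply: eq_card => -[i j]; rewrite !inE /=.
    apply/eqP/codomP => [->|[k [-> ->]]//].
    by exists j.
  have -> : #|predC [pred p : 'I_t * 'I_t | p.1 == p.2]| =
      #|[pred p : 'I_t * 'I_t | p.1 != p.2]| by apply: eq_card.
  by have := mul_bin_diag t 1; rewrite bin1; case: (t) => [|t'] /=; nia.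
apply: leq_trans (leq_mul badE (leqnn _)) _; rewrite big_distrl /= -pairsE.
by rewrite -sum_nat_const; apply: leq_sum.
Qed.

(** * The error term *)

Definition decay (R : realType) (K : nat) : R := 6 / ln 2 * Num.sqrt (harmonic K).

Lemma cvg_decay (R : realType) : (@decay R @ \oo --> (0 : R))%classic.
Proof.
rewrite -(mulr0 (6 / ln 2)) -sqrtr0; apply: cvgMr.
by apply: continuous_cvg; [exact: sqrt_continuous|exact: cvg_harmonic].
Qed.

(** The right-hand side is [expR (12 K / sqrt (K + 1))], whose exponent of order [sqrt K] outgrows
    the logarithm of the left. *)
Lemma powR2_decay_ge (R : realType) (K : nat) : (0 < K)%N ->
  2 * K.*2.+1%:R <= 2 `^ (2 * decay R K * K%:R) :> R.
Proof.
move=> K_gt0; have ln2 : 0 < ln 2 :> R by rewrite ln_gt0 // ltr1n.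
set s : R := Num.sqrt K.+1%:R.
have s2 : s ^+ 2 = K%:R + 1 by rewrite sqr_sqrtr // -natr1.
have s_gt0 : 0 < s by rewrite sqrtr_gt0.
have K1 : 1 <= K%:R :> R by rewrite ler1n.
have -> : 2 `^ (2 * decay R K * K%:R) = expR (12 * K%:R / s).
  rewrite /powR gt_eqF // /decay /harmonic /= sqrtrV // -/s; congr expR.
  by field; rewrite !gt_eqF.
(* [4K + 2 <= 9 (K + 1) = (3 s) ^ 2] on the left; [6 s <= 12 K / s] on the right, since
   [s ^ 2 = K + 1 <= 2K]. *)
apply: (@le_trans _ _ (expR (3 * s) ^+ 2)).
  have := expR_ge1Dx (3 * s) => e.
  apply: (@le_trans _ _ ((3 * s) ^+ 2)); last by rewrite lerXn2r ?nnegrE; lra.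
  rewrite exprMn s2 -(natr1 K.*2) -muln2 natrM; nra.
rewrite -expRM_natl ler_expR ler_pdivlMr //; nra.
Qed.

(** * The bound on the probability *)

Local Open Scope classical_set_scope.

Theorem mainTheorem3 (R : realType) :
  exists2 eta : nat -> R,
    eta @ \oo --> (0 : R) &
    forall (K t n L H : nat) (delta : R),
      (1 <= K)%N -> (2 <= t)%N ->
      0 < delta -> delta < 1 / 2 ->
      L%:R = delta * K%:R ->
      H%:R = (1 - delta) * K%:R ->
      (t * K <= n)%N ->
      forall before : 'I_n -> rel 'I_n,
        (forall z, linear_order (before z)) ->
        forall z : 'I_n,
          obs_Pr R K (bad_event K L H (before z) : pred (observers n t)) <=
            'C(t, 2)%:R * 2 `^ (- 2 * (1 - H2 delta - eta K) * K%:R).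
Proof.
exists (@decay R); first exact: cvg_decay.
move=> K t n L H d K_gt0 _ d_gt0 d_lt LK HK _ before before_lin z.
have HLK : (H + L)%N = K.
  by apply/eqP; rewrite -(eqr_nat R) natrD LK HK; apply/eqP; ring.
set N := binomial_head K L; pose w : R := 2 `^ (- (H2 d * K%:R)).
have w_gt0 : 0 < w by rewrite powR_gt0.
have Nw : N%:R * w <= 1.
  rewrite /w (powR2_H2 d_gt0 _ LK HK); last by lra.
  by rewrite (_ : H = (K - L)%N) ?binomial_head_le //; lia.
set c := _ * _.
have c_ge0 : 0 <= c by rewrite mulr_ge0 // powR_ge0.
pose b : R := 'C(K.*2, K)%:R.
have b_gt0 : 0 < b by rewrite ltr0n bin_gt0 -addnn leq_addr.
have cE : c = 'C(t, 2)%:R * (4 ^+ K)^-1 * (w ^+ 2)^-1 * 2 `^ (2 * decay R K * K%:R).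
  have -> : 4 ^+ K = 2 `^ (2 * K%:R) :> R.
    by rewrite powRrM powR_mulrn ?powR_ge0 // powR_mulrn //; congr (_ ^+ _); ring.
  rewrite /c -powR_mulrn ?powR_ge0 // -powRrM -!powRN -!mulrA -!powRD ?pnatr_eq0 ?implybT //.
  by congr (_ * _ `^ _); rewrite /decay; ring.
(* The entropy bound gives [N ^ 2 <= w ^ (-2)]. The factor [2 ^ (2 * decay * K)] pays for the two
   orders of a pair and for the [2K + 1] lost on the central binomial. *)
have cb : 2 * 'C(t, 2)%:R * N%:R ^+ 2 <= c * b.
  have b4 : 4 ^+ K <= K.*2.+1%:R * b by rewrite -natrX -natrM ler_nat central_binomial_ge.
  have := powR2_decay_ge R K_gt0; rewrite cE; set e := _ `^ _ => e_ge.
  have N2 : N%:R ^+ 2 <= (w ^+ 2)^-1.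
    rewrite -[leRHS]mul1r ler_pdivlMr ?exprn_gt0 // -exprMn expr_le1 //.
    by rewrite mulr_ge0 // ltW.
  have eb : 2 <= (4 ^+ K)^-1 * (e * b).
    rewrite mulrC ler_pdivlMr ?exprn_gt0 //.
    have := ler_wpM2r (ltW b_gt0) e_ge; have := ler_wpM2l (ler0n R 2) b4; lra.
  have -> : 'C(t, 2)%:R * (4 ^+ K)^-1 * (w ^+ 2)^-1 * e * b =
    'C(t, 2)%:R * (((4 ^+ K)^-1 * (e * b)) * (w ^+ 2)^-1) by ring.
  have -> : 2 * 'C(t, 2)%:R * N%:R ^+ 2 = 'C(t, 2)%:R * (2 * N%:R ^+ 2) :> R by ring.
  by rewrite ler_wpM2l // ler_pM // exprn_ge0.
(* The bound is proved for each fixed union [U], hence holds for the average over [U]. *)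
rewrite /obs_Pr; apply: unif_mean_le => //.
rewrite mulr_natr -sumr_const; apply: ler_sum => U _; apply: unif_mean_le => //.
set B := obs_blocks t K U.
have -> : \sum_(O in B) (bad_event K L H (before z) O)%:R =
    #|[set O in B | bad_event K L H (before z) O]%SET|%:R :> R.
  by rewrite -natr_sum -big_mkcondr /= sum1dep_card.
rewrite -(ler_pM2r b_gt0) -natrM.
have := card_bad_event t U (before_lin z) HLK; rewrite -/B -(ler_nat R) => /le_trans; apply.
rewrite -muln2 !natrM.
have := ler_wpM2r (ler0n R #|B|) cb; lra.
Qed.
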